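(* Let $f\colon\mathbb{R}^n\to\mathbb{R}$ be continuously differentiable, let $M\subset\mathbb{R}^n$ be closed, and let $K\colon\mathbb{R}^n\rightrightarrows\mathbb{R}^m$ be a set-valued mapping with closed graph. Let $\bar z\in M\cap\operatorname{dom}K$ be a feasible point of $(\mathrm P)$: $\min_z\{f(z)\mid z\in M\cap\operatorname{dom}K\}$, and let $K$ be inner semicompact w.r.t. $\operatorname{dom}K$ at $\bar z$. Then the following hold. (a) If $\bar z$ is implicitly B-stationary, then it is abstractly B-stationary and explicitly B-stationary. (b) $\bar z$ is explicitly B-stationary if and only if it is explicitly B-stationary w.r.t. each $\bar\lambda\in K(\bar z)$. (c) If $\bar z$ is explicitly B-stationary and if $K$ is inner calm* in the fuzzy sense at $\bar z$ w.r.t. $\operatorname{dom}K$, then $\bar z$ is implicitly B-stationary.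
   Context: $\operatorname{gph}K:=\{(z,\lambda)\mid\lambda\in K(z)\}$, $\operatorname{dom}K:=\{z\mid K(z)\neq\emptyset\}$; $\|\cdot\|$ is the Euclidean norm. Tangent cone: for $\Omega\subset\mathbb{R}^n$ locally closed around $\bar z\in\Omega$, $T_\Omega(\bar z)$ is the set of all $w$ for which there are $t_k\downarrow0$ (with $t_k>0$) and $w_k\to w$ with $\bar z+t_kw_k\in\Omega$ for all $k$. Graphical derivative: for $(\bar z,\bar\lambda)\in\operatorname{gph}K$, $DK(\bar z,\bar\lambda)\colon\mathbb{R}^n\rightrightarrows\mathbb{R}^m$ is defined by $\operatorname{gph}DK(\bar z,\bar\lambda):=T_{\operatorname{gph}K}(\bar z,\bar\lambda)$. $K$ is inner semicompact w.r.t. $\operatorname{dom}K$ at $\bar z\in\operatorname{dom}K$ if for each sequence $\{z_k\}\subset\operatorname{dom}K$ with $z_k\to\bar z$ there is a sequence $\{\lambda_k\}$ possessing a bounded subsequence such that $\lambda_k\in K(z_k)$ for all $k$. (This together with closedness of $\operatorname{gph}K$ makes $\operatorname{dom}K$ closed locally around $\bar z$.) $K$ is inner calm* in the fuzzy sense w.r.t. $\operatorname{dom}K$ at $\bar z\in\operatorname{dom}K$ if for each $d\in T_{\operatorname{dom}K}(\bar z)$ with $\|d\|=1$ there exist $\kappa_d>0$, $\bar\lambda\in\mathbb{R}^m$, and sequences $t_k\downarrow0$ (with $t_k>0$), $d_k\to d$, $\lambda_k\to\bar\lambda$ such that $\lambda_k\in K(\bar z+t_kd_k)$ and $\|\lambda_k-\bar\lambda\|\le\kappa_dt_k\|d_k\|$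 for all $k$. Stationarity of $\bar z$: - abstractly B-stationary: $f'(\bar z)w\ge0$ for all $w\in T_{M\cap\operatorname{dom}K}(\bar z)$; - implicitly B-stationary: $f'(\bar z)w\ge0$ for all $w\in T_M(\bar z)\cap T_{\operatorname{dom}K}(\bar z)$; - explicitly B-stationary w.r.t. $\bar\lambda\in K(\bar z)$: $f'(\bar z)w\ge0$ for all $w\in T_M(\bar z)\cap\operatorname{dom}DK(\bar z,\bar\lambda)$; - explicitly B-stationary: the preceding condition holds for all $\bar\lambda\in K(\bar z)$. *)

(* Defs.v *)
From HB Require Import structures.
From mathcomp Require Import all_boot all_order all_algebra.
From mathcomp Require Import all_classical all_reals all_analysis.

Set Implicit Arguments.
Unset Strict Implicit.
Unset Printing Implicit Defensive.

Import Order.TTheory GRing.Theory Num.Theory.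
Import numFieldNormedType.Exports.

Local Open Scope classical_set_scope.
Local Open Scope ring_scope.

Section Euclidean.
Context {R : realType} {n : nat}.

(* The library norm [`|x|] on row vectors is the max norm; it induces the same
   topology, but the Euclidean norm has to be defined where its value counts. *)
Definition enorm (x : 'rV[R]_n) : R := Num.sqrt (\sum_i x ord0 i ^+ 2).

Definition grad (f : 'rV[R]_n -> R) (z : 'rV[R]_n) : 'rV[R]_n :=
  \row_i 'd f z ('e_i : 'rV[R]_n).

(* In finite dimension, continuity of the gradient is continuity of [z |-> 'd f z]
   for the operator norm. *)
Definition continuously_differentiable (f : 'rV[R]_n -> R) : Prop :=
  (forall z, differentiable f z) /\ continuous (grad f).

End Euclidean.

Section TangentCone.
Context {R : realType} {V : normedModType R}.

(* [t_k] decreasing to 0 is read as [t_k > 0] and [t_k --> 0]; requiring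
   monotonicity as well gives the same cone, by passing to subsequences. *)
Definition tangent_cone (Omega : set V) (zbar : V) : set V :=
  [set w | exists (t : nat -> R) (w_ : nat -> V),
    [/\ forall k, 0 < t k, t @ \oo --> 0, w_ @ \oo --> w
      & forall k, Omega (zbar + t k *: w_ k)]].

End TangentCone.

Section SetValued.
Context {R : realType} {n m : nat}.
Implicit Types (f : 'rV[R]_n -> R) (M : set 'rV[R]_n).
Implicit Types (K : 'rV[R]_n -> set 'rV[R]_m).

Definition gph K : set ('rV[R]_n * 'rV[R]_m) := [set p | K p.1 p.2].

Definition dom K : set 'rV[R]_n := [set z | K z !=set0].

Definition graphical_derivative K (zbar : 'rV[R]_n) (lbar : 'rV[R]_m) :
    'rV[R]_n -> set 'rV[R]_m :=
  fun w => [set mu | tangent_cone (gph K) (zbar, lbar) (w, mu)].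

(* The next two notions are taken relative to [dom K]. *)
Definition inner_semicompact K (zbar : 'rV[R]_n) : Prop :=
  forall z_ : nat -> 'rV[R]_n,
    (forall k, dom K (z_ k)) -> z_ @ \oo --> zbar ->
    exists l_ : nat -> 'rV[R]_m,
      (forall k, K (z_ k) (l_ k)) /\
      exists phi : nat -> nat,
        increasing_seq phi /\ bounded_set (range (l_ \o phi)).

Definition inner_calm_star_fuzzy K (zbar : 'rV[R]_n) : Prop :=
  forall d : 'rV[R]_n, tangent_cone (dom K) zbar d -> enorm d = 1 ->
    exists (kappa : R) (lbar : 'rV[R]_m)
           (t : nat -> R) (d_ : nat -> 'rV[R]_n) (l_ : nat -> 'rV[R]_m),
      0 < kappa /\
      [/\ forall k, 0 < t k, t @ \oo --> 0, d_ @ \oo --> d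
        & l_ @ \oo --> lbar] /\
      forall k, K (zbar + t k *: d_ k) (l_ k) /\
                enorm (l_ k - lbar) <= kappa * t k * enorm (d_ k).

Definition abstractly_Bstationary f M K (zbar : 'rV[R]_n) : Prop :=
  forall w, tangent_cone (M `&` dom K) zbar w -> 0 <= 'd f zbar w.

Definition implicitly_Bstationary f M K (zbar : 'rV[R]_n) : Prop :=
  forall w, (tangent_cone M zbar `&` tangent_cone (dom K) zbar) w ->
    0 <= 'd f zbar w.

Definition explicitly_Bstationary_wrt f M K (zbar : 'rV[R]_n)
    (lbar : 'rV[R]_m) : Prop :=
  forall w, (tangent_cone M zbar `&` dom (graphical_derivative K zbar lbar)) w ->
    0 <= 'd f zbar w.

Definition explicitly_Bstationary f M K (zbar : 'rV[R]_n) : Prop :=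
  forall lbar, K zbar lbar -> explicitly_Bstationary_wrt f M K zbar lbar.

End SetValued.

(* Main.v *)
Require Import Defs.
From HB Require Import structures.
From mathcomp Require Import all_boot all_order all_algebra.
From mathcomp Require Import all_classical all_reals all_analysis.

Set Implicit Arguments.
Unset Strict Implicit.
Unset Printing Implicit Defensive.

Import Order.TTheory GRing.Theory Num.Theory.
Import numFieldNormedType.Exports.

Local Open Scope classical_set_scope.
Local Open Scope ring_scope.

(** The inclusions between the cones of directions decide everything, since
    each stationarity notion says that the linear form ['d f zbar] is
    nonnegative on one of them.

    Tangent cones are monotone, so a direction tangent to [M `&` dom K] is
    tangent to both sets; and forgetting the second component of a sequence in
    [gph K] turns a tangent [(w, mu)] of [gph K] into a tangent [w] of [dom K]
    ([graphical_derivative_tangent]). These two facts give (a), while (b) is the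
    definition of explicit B-stationarity.

    For (c) a reverse inclusion is needed, along single directions. A nonzero
    [w] tangent to [dom K] may be rescaled to Euclidean norm one, because both
    the cones and the sign of ['d f zbar w] are invariant under positive
    scaling. Inner calmness* then provides points [zbar + t_k d_k] with values
    [l_k] of [K] tending to some [lbar], which lies in [K zbar] because [gph K]
    is closed. The calmness estimate bounds the difference quotients
    [(l_k - lbar) / t_k], and by compactness of balls in finite dimension a
    subsequence converges to some [mu]. Along it, [(d_k, (l_k - lbar) / t_k)]
    shows that [(d, mu)] is tangent to [gph K] at [(zbar, lbar)], so that [d]
    is in the domain of the graphical derivative there
    ([inner_calm_star_fuzzy_graphical_derivative]). *)

(** * Tangent cones *)

Section TangentConeTheory.
Context {R : realType} {V : normedModType R}.
Implicit Types (A B : set V) (z w : V).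

Lemma tangent_coneS A B z :
  A `<=` B -> tangent_cone A z `<=` tangent_cone B z.
Proof.
move=> AB w [t [w_ [t0 tcvg wcvg Aw]]]; exists t, w_.
by split=> // k; exact: AB.
Qed.

(** The step lengths are divided by [a], which leaves the points
    [z + t k *: w_ k] unchanged. *)
Lemma tangent_coneZ A z w (a : R) :
  0 < a -> tangent_cone A z w -> tangent_cone A z (a *: w).
Proof.
move=> a0 [t [w_ [t0 tcvg wcvg Aw]]].
exists (fun k => a^-1 * t k), (fun k => a *: w_ k); split.
- by move=> k; rewrite mulr_gt0 ?invr_gt0.
- by rewrite -(mulr0 a^-1); exact: cvgMr.
- exact: cvgZr.
- by move=> k; rewrite scalerA mulrAC mulVf ?gt_eqF// mul1r.
Qed.

End TangentConeTheory.

(** * The Euclidean norm and convergent subsequences *)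

Section EuclideanNorm.
Context {R : realType} {n : nat}.
Implicit Types (x : 'rV[R]_n) (a : R).

Lemma enorm_ge0 x : 0 <= enorm x.
Proof. exact: sqrtr_ge0. Qed.

Lemma enormZ a x : enorm (a *: x) = `|a| * enorm x.
Proof.
rewrite /enorm -sqrtr_sqr -sqrtrM ?sqr_ge0// mulr_sumr.
by congr Num.sqrt; apply: eq_bigr => i _; rewrite mxE exprMn.
Qed.

Lemma le_norm_enorm x : `|x| <= enorm x.
Proof.
rewrite /Num.norm/= mx_normrE; apply: bigmax_le => [|[i j] _ /=].
  exact: enorm_ge0.
rewrite ord1 -sqrtr_sqr ler_wsqrtr// (bigD1 j)//= lerDl.
by apply: sumr_ge0 => k _; exact: sqr_ge0.
Qed.

Lemma enorm_gt0 x : x != 0 -> 0 < enorm x.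
Proof. by rewrite -normr_gt0 => /lt_le_trans; apply; exact: le_norm_enorm. Qed.

Lemma enorm_continuous : continuous (@enorm R n).
Proof.
move=> x; apply: (@continuous_comp _ _ _ (fun y : 'rV[R]_n => \sum_i y ord0 i ^+ 2)
  (@Num.sqrt R)); last exact: sqrt_continuous.
move: x; apply: continuous_big => [|i _ x]; first exact: add_continuous.
apply: (@continuous_comp _ _ _ (fun y : 'rV[R]_n => y ord0 i) (fun r => r ^+ 2)).
  exact: coord_continuous.
exact: exprn_continuous.
Qed.

(** A closed ball is compact, so the sequence has a cluster point [mu]; the
    index [phi j] is chosen at least [j], with its term at distance less than
    [1 / (j + 1)] from [mu]. Being a subsequence is expressed by [phi] tending
    to infinity, which is what transports limits. *)
Lemma eventually_bounded_cvg_subseq (u : nat -> 'rV[R]_n) (B : R) :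
  (\forall k \near \oo, `|u k| <= B) ->
  exists (mu : 'rV[R]_n) (phi : nat -> nat),
    phi @ \oo --> \oo /\ (u \o phi) @ \oo --> mu.
Proof.
move=> uB.
have cball : compact [set x : 'rV[R]_n | `|x| <= B].
  apply: bounded_closed_compact.
    exists B; split; first exact: num_real.
    by move=> r /ltW Br x /= /le_trans; apply.
  apply: (@closed_comp _ _ (fun x : 'rV[R]_n => `|x|) [set r | r <= B]).
    by move=> x _; exact: norm_continuous.
  exact: closed_le.
have [mu [_ clmu]] := cball (u @ \oo) _ uB.
have near_mu (j : nat) : exists k, (j <= k)%N /\ ball mu (harmonic j) (u k).
  have tail : (u @ \oo) (u @` [set k | (j <= k)%N]).
    by exists j => // k jk /=; exists k.
  have mu_nbhs : nbhs mu (ball mu (harmonic j : R)) by apply: nbhsx_ballx; exact: harmonic_gt0.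
  have [_ [[k jk <-] bk]] := clmu _ _ tail mu_nbhs.
  by exists k.
have [phi phiP] := choice near_mu.
exists mu, phi; split.
  move=> A [N _ NA]; exists N => // j /= Nj; apply: NA => /=.
  exact: leq_trans Nj (phiP j).1.
apply/cvgrPdist_lt => e e0; near=> j.
have [_] := phiP j; rewrite -ball_normE /= => /lt_trans; apply.
near: j.
have /cvgrPdist_lt /(_ e e0) := @cvg_harmonic R.
by apply: filterS => j; rewrite sub0r normrN ger0_norm// harmonic_ge0.
Unshelve. all: by end_near. Qed.

End EuclideanNorm.

(** * Tangents to the domain and the graphical derivative *)

Section GraphicalDerivative.
Context {R : realType} {n m : nat}.
Implicit Types (K : 'rV[R]_n -> set 'rV[R]_m) (z w : 'rV[R]_n).

(** The first components of a sequence witnessing a tangent of [gph K] witness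
    a tangent of [dom K], its second components being the values of [K]. *)
Lemma graphical_derivative_tangent K z (l : 'rV[R]_m) :
  dom (graphical_derivative K z l) `<=` tangent_cone (dom K) z.
Proof.
move=> w [mu [t [p [t0 tcvg pcvg Kp]]]].
exists t, (fun k => (p k).1); split=> //.
  exact: (cvg_comp _ _ pcvg cvg_fst).
by move=> k; exists (l + t k *: (p k).2); exact: Kp.
Qed.

(** The calmness estimate is exactly a bound on the difference quotients [q k]
    of the values of [K], and a limit of a subsequence of them completes [d] to
    a tangent of [gph K]. *)
Lemma inner_calm_star_fuzzy_graphical_derivative K z d :
  closed (gph K) -> inner_calm_star_fuzzy K z ->
  tangent_cone (dom K) z d -> enorm d = 1 ->
  exists2 l, K z l & dom (graphical_derivative K z l) d.
Proof.
move=> Kcl calm Td d1.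
have [kappa [l [t [d_ [l_ [kappa0 [[t0 tcvg dcvg lcvg] Kl]]]]]]] := calm d Td d1.
have zcvg : (fun k => z + t k *: d_ k) @ \oo --> z.
  rewrite -[X in _ --> X]addr0 -(scale0r d).
  by apply: cvgD; [exact: cvg_cst|exact: cvgZ].
exists l.
  apply: (@closed_cvg _ _ \oo _ (fun k => (z + t k *: d_ k, l_ k)) (gph K) Kcl
    _ (z, l)).
    by apply: nearW => k; exact: (Kl k).1.
  exact: (cvg_pair zcvg lcvg).
pose q k := (t k)^-1 *: (l_ k - l).
have qB : \forall k \near \oo, `|q k| <= kappa * 2.
  (* The constant 2 is any bound above the limit 1 of [enorm (d_ k)]. *)
  have ecvg : (enorm \o d_) @ \oo --> (1 : R).
    by rewrite -d1; apply: continuous_cvg => //; exact: enorm_continuous.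
  have : \forall k \near \oo, (enorm \o d_) k <= 2.
    by apply: (cvgr_le _ ecvg); rewrite ltr1n.
  apply: filterS => k /= dk2.
  apply: le_trans (le_norm_enorm _) _.
  rewrite enormZ gtr0_norm ?invr_gt0// ler_pdivrMl//.
  apply: le_trans (Kl k).2 _.
  by rewrite (mulrC kappa) -mulrA ler_pM2l// ler_pM2l.
have [mu [phi [phioo qcvg]]] := eventually_bounded_cvg_subseq qB.
exists mu, (t \o phi), (fun j => (d_ (phi j), q (phi j))); split.
- by move=> j; exact: t0.
- exact: cvg_comp phioo tcvg.
- exact: (cvg_pair (cvg_comp _ _ phioo dcvg) qcvg).
- move=> j; rewrite /gph /=.
  rewrite scalerA mulfV ?gt_eqF// scale1r [l + _]addrC subrK.
  exact: (Kl (phi j)).1.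
Qed.

End GraphicalDerivative.

(** * Relations between the stationarity notions *)

Section Stationarity.
Context {R : realType} {n m : nat}.
Implicit Types (f : 'rV[R]_n -> R) (M : set 'rV[R]_n).
Implicit Types (K : 'rV[R]_n -> set 'rV[R]_m) (z : 'rV[R]_n).

Lemma implicitly_abstractly_Bstationary f M K z :
  implicitly_Bstationary f M K z -> abstractly_Bstationary f M K z.
Proof.
move=> impl w Tw; apply: impl; split.
  by apply: tangent_coneS Tw; exact: subIsetl.
by apply: tangent_coneS Tw; exact: subIsetr.
Qed.

Lemma implicitly_explicitly_Bstationary f M K z :
  implicitly_Bstationary f M K z -> explicitly_Bstationary f M K z.
Proof.
move=> impl l _ w [Mw Kw]; apply: impl; split=> //.
exact: graphical_derivative_tangent Kw.
Qed.

Lemma explicitly_implicitly_Bstationary f M K z :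
  closed (gph K) -> inner_calm_star_fuzzy K z ->
  explicitly_Bstationary f M K z -> implicitly_Bstationary f M K z.
Proof.
move=> Kcl calm expl w [Mw Kw].
have [->|w0] := eqVneq w 0; first by rewrite linear0.
have nw0 : 0 < (enorm w)^-1 by rewrite invr_gt0 enorm_gt0.
have unit_w : enorm ((enorm w)^-1 *: w) = 1.
  by rewrite enormZ gtr0_norm// mulVf// gt_eqF// enorm_gt0.
have [l Kl DKw] := inner_calm_star_fuzzy_graphical_derivative Kcl calm
  (tangent_coneZ nw0 Kw) unit_w.
have := expl l Kl _ (conj (tangent_coneZ nw0 Mw) DKw).
by rewrite linearZ/= pmulr_rge0.
Qed.

End Stationarity.

Theorem theorem4p8 (R : realType) (n m : nat)
  (f : 'rV[R]_n -> R) (M : set 'rV[R]_n) (K : 'rV[R]_n -> set 'rV[R]_m)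
  (zbar : 'rV[R]_n)
  (f_C1 : continuously_differentiable f)
  (M_closed : closed M)
  (K_closed : closed (gph K))
  (zbar_feasible : (M `&` dom K) zbar)
  (K_semicompact : inner_semicompact K zbar) :
  [/\ implicitly_Bstationary f M K zbar ->
        abstractly_Bstationary f M K zbar /\
        explicitly_Bstationary f M K zbar,
      explicitly_Bstationary f M K zbar <->
        (forall lbar : 'rV[R]_m, K zbar lbar ->
           explicitly_Bstationary_wrt f M K zbar lbar)
    & explicitly_Bstationary f M K zbar ->
      inner_calm_star_fuzzy K zbar ->
        implicitly_Bstationary f M K zbar].
Proof.
split=> [impl| |expl calm].
- split; first exact: implicitly_abstractly_Bstationary.
  exact: implicitly_explicitly_Bstationary.
- exact: iff_refl.
- by apply: explicitly_implicitly_Bstationary => //.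
Qed.
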